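(* Let $k\ge1$. If a chord diagram $C$ is $k$-terminal and has at least $k+1$ chords, then $C$ is $k$-connected.
   Context: A chord diagram of size $n$ is a perfect matching of $\{1,\dots,2n\}$; chords are ordered pairs $(a,b)$ with $a<b$, $a$ the source and $b$ the sink. For chords $c_1=(a_1,b_1)$, $c_2=(a_2,b_2)$ with $a_1<a_2$, they cross if $a_2<b_1<b_2$, and then $c_2$ is a right neighbor of $c_1$. The intersection graph has chords as vertices and crossings as edges. A chord is $j$-terminal if it has at most $j-1$ right neighbors. A diagram is $k$-terminal if, for all $1\le j\le k$, there is no $j$-terminal chord before the $j$th-to-last chord in the order of sources. The connectivity $\kappa(C)$ is the vertex connectivity of the (undirected) intersection graph: the minimum number of vertices whose removal disconnects it, with the usual convention that a complete graph on $m$ vertices has connectivity $m-1$. $C$ is $k$-connected if $\kappa(C)\ge k$. *)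

(* Defs.v *)
(* The points 1, ..., 2n of a diagram are the ordinals 0, ..., 2n - 1. *)
From mathcomp Require Import all_boot.

Set Implicit Arguments.
Unset Strict Implicit.
Unset Printing Implicit Defensive.

Definition chord (n : nat) : finType := ('I_(2 * n) * 'I_(2 * n))%type.

Definition source (n : nat) (c : chord n) : 'I_(2 * n) := c.1.
Definition sink (n : nat) (c : chord n) : 'I_(2 * n) := c.2.

Definition perfect_matching (n : nat) (M : {set chord n}) : bool :=
  [forall c in M, source c < sink c] &&
  [forall p, #|[set c in M | (p == source c) || (p == sink c)]| == 1].

Record chord_diagram (n : nat) := ChordDiagram {
  chords :> {set chord n};
  chordsP : perfect_matching chords
}.

Definition right_neighbor (n : nat) (c1 c2 : chord n) : bool :=
  [&& source c1 < source c2, source c2 < sink c1 & sink c1 < sink c2].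

Definition cross (n : nat) (c1 c2 : chord n) : bool :=
  right_neighbor c1 c2 || right_neighbor c2 c1.

Definition terminal_chord (n : nat) (C : chord_diagram n) (j : nat)
    (c : chord n) : bool :=
  #|[set d in chords C | right_neighbor c d]| <= j.-1.

(* Read for 1 <= j; no such chord exists when C has fewer than j chords. *)
Definition nth_to_last (n : nat) (C : chord_diagram n) (j : nat)
    (d : chord n) : bool :=
  (d \in chords C) && (#|[set e in chords C | source d < source e]| == j.-1).

Definition terminal (n : nat) (C : chord_diagram n) (k : nat) : Prop :=
  forall j, 1 <= j <= k ->
  forall c d, c \in chords C -> nth_to_last C j d -> source c < source d ->
    ~~ terminal_chord C j c.

Definition complete (T : finType) (e : rel T) : bool :=
  [forall x, forall y, (x != y) ==> e x y].

Definition disconnects (T : finType) (e : rel T) (S : {set T}) : bool :=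
  [exists x, exists y, [&& x \notin S, y \notin S &
    ~~ connect [rel u v | [&& u \notin S, v \notin S & e u v]] x y]].

(* In the second branch some set S disconnects e (all vertices except two
   non-adjacent ones), so the default value #|T| is never reached. *)
Definition vertex_connectivity (T : finType) (e : rel T) : nat :=
  if complete e then #|T|.-1
  else \big[minn/#|T|]_(S : {set T} | disconnects e S) #|S|.

Definition intersection_graph (n : nat) (C : chord_diagram n) :
    rel {c : chord n | c \in chords C} :=
  fun c1 c2 => cross (val c1) (val c2).

Definition connectivity (n : nat) (C : chord_diagram n) : nat :=
  vertex_connectivity (@intersection_graph n C).

Definition connected (n : nat) (C : chord_diagram n) (k : nat) : Prop :=
  k <= connectivity C.

(* Main.v *)
(* Write [t] for the number of chords starting after [c]. Terminality says that
   [c] has at least [min k t] right neighbors. Hence the last [k + 1] chords are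
   pairwise crossing, and after removing fewer than [k] chords every other
   surviving chord still has a surviving right neighbor; moving repeatedly to
   the right joins each surviving chord to that clique. *)
Require Import Defs.
From mathcomp Require Import all_boot.

Set Implicit Arguments.
Unset Strict Implicit.
Unset Printing Implicit Defensive.

Definition later (n : nat) (C : chord_diagram n) (c : chord n) :=
  [set e in chords C | source c < source e].

Definition right_neighbors (n : nat) (C : chord_diagram n) (c : chord n) :=
  [set d in chords C | right_neighbor c d].

Lemma source_inj (n : nat) (C : chord_diagram n) :
  {in chords C &, injective (fun c => nat_of_ord (source c))}.
Proof.
move=> x y xC yC /= /val_inj sxy.
have /andP[_ /forallP/(_ (source x))/cards1P[z Ez]] := chordsP C.
have: x \in [set z] by rewrite -Ez inE xC eqxx.
have: y \in [set z] by rewrite -Ez inE yC -sxy eqxx.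
by rewrite !inE => /eqP -> /eqP ->.
Qed.

(** The number of later chords is the measure that makes walks to the right terminate. *)
Lemma later_proper (n : nat) (C : chord_diagram n) (c d : chord n) :
  d \in later C c -> #|later C d| < #|later C c|.
Proof.
move=> dc; apply/proper_card/properP; split; last first.
  by exists d => //; rewrite inE ltnn andbF.
move: dc; rewrite inE => /andP[_ cd].
apply/subsetP => e; rewrite !inE => /andP[-> de] /=.
exact: ltn_trans de.
Qed.

Lemma right_neighbors_sub_later (n : nat) (C : chord_diagram n) (c : chord n) :
  right_neighbors C c \subset later C c.
Proof. by apply/subsetP => d; rewrite !inE => /andP[-> /and3P[]]. Qed.

(** Passing from a chord to the next one by source lowers [#|later C _|] by exactly one, so the walk
    from [c] to the right attains every count [j] below the initial one. *)
Lemma ex_nth_to_last (n : nat) (C : chord_diagram n) (c : chord n) (j : nat) :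
  j < #|later C c| -> exists2 d, source c < source d & nth_to_last C j.+1 d.
Proof.
have [s] := ubnP #|later C c|; elim: s c => // s IH c lt_cs lt_jc.
have /card_gt0P[e0 e0L] : 0 < #|later C c| by apply: leq_ltn_trans lt_jc.
(* [d] is the immediate successor of [c] in the order of sources. *)
case: (arg_minnP (fun d => source d : nat) e0L) => d dL dmin.
have later_c : later C c = d |: later C d.
  apply/setP => e; rewrite in_setU1; have [-> //|ned /=] := eqVneq e d.
  have /setIdP[dC cd] := dL.
  apply/idP/idP => [eL | /setIdP[eC de]]; last first.
    by rewrite inE eC (ltn_trans cd de).
  have /setIdP[eC ce] := eL.
  rewrite inE eC ltn_neqAle dmin // andbT; apply: contra_neq ned => Esrc.
  exact/esym/(source_inj dC eC).
have /setIdP[dC cd] := dL.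
have cardc : #|later C c| = #|later C d|.+1.
  by rewrite later_c cardsU1 inE ltnn andbF.
move: lt_jc; rewrite cardc ltnS leq_eqVlt => /orP[/eqP Ej | lt_jd].
  by exists d => //; rewrite /nth_to_last dC -/(later C d) Ej eqxx.
have [|d' dd' d'P] := IH d _ lt_jd; first by rewrite -ltnS -cardc.
by exists d' => //; apply: ltn_trans dd'.
Qed.

(** If the minimum is [j.+1], the chord with exactly [j] later chords starts after [c], so
    terminality at index [j.+1] gives [c] more than [j] right neighbors. *)
Lemma terminal_right_neighbors (n k : nat) (C : chord_diagram n) (c : chord n) :
  terminal C k -> c \in chords C ->
  minn k #|later C c| <= #|right_neighbors C c|.
Proof.
move=> Ct cC; case Ej: (minn k _) => [//|j].
have /andP[le_jk lt_jc] : (j.+1 <= k) && (j < #|later C c|).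
  by rewrite -leq_min Ej.
have [d cd dP] := ex_nth_to_last lt_jc.
by have := Ct j.+1 le_jk c d cC dP cd; rewrite /terminal_chord -ltnNge.
Qed.

(** At most [k] later chords means that [c] is among the last [k + 1]. The lower bound on right
    neighbors is then the number of all later chords, which forces equality of the two sets. *)
Lemma terminal_cross_last (n k : nat) (C : chord_diagram n) (c d : chord n) :
  terminal C k -> c \in chords C -> #|later C c| <= k -> d \in later C c ->
  right_neighbor c d.
Proof.
move=> Ct cC le_ck dL.
have := terminal_right_neighbors Ct cC; rewrite (minn_idPr le_ck) => le_card.
have /eqP Ern : right_neighbors C c == later C c.
  by rewrite eqEcard right_neighbors_sub_later.
by move: dL; rewrite -Ern inE => /andP[].
Qed.

Lemma terminal_not_disconnects (n k : nat) (C : chord_diagram n)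
    (S : {set {c : chord n | c \in chords C}}) :
  terminal C k -> #|S| < k -> ~~ disconnects (@intersection_graph n C) S.
Proof.
move=> Ct ltSk; rewrite /disconnects; set e := [rel u v | _].
have e_sym : symmetric e.
  by move=> u v; rewrite /e /= /intersection_graph /cross orbC andbCA.
have to_last x : x \notin S ->
    exists y, [/\ y \notin S, #|later C (val y)| <= k & connect e x y].
  have [s] := ubnP #|later C (val x)|; elim: s x => // s IH x lt_xs xS.
  have [le_xk | lt_kx] := leqP #|later C (val x)| k; first by exists x.
  have := terminal_right_neighbors Ct (valP x).
  rewrite (minn_idPl (ltnW lt_kx)) => le_kx.
  (* At least [k] right neighbors cannot all lie in [S], which has fewer than [k] elements. *)
  have /subsetPn[d dR dS] : ~~ (right_neighbors C (val x) \subset val @: S).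
    apply: contraL ltSk => /subset_leq_card le_xS.
    by rewrite -leqNgt (leq_trans le_kx) // (leq_trans le_xS) ?leq_imset_card.
  have /setIdP[dC xd] := dR.
  pose v : {c : chord n | c \in chords C} := Sub d dC.
  have vS : v \notin S by apply: contra dS => vS; apply/imsetP; exists v.
  have [|y [yS le_yk vy]] := IH v _ vS.
    rewrite -ltnS; apply: leq_trans lt_xs; rewrite ltnS.
    exact/later_proper/(subsetP (right_neighbors_sub_later _ _)).
  exists y; split=> //; apply: connect_trans vy; apply: connect1.
  by rewrite /e /= xS vS /intersection_graph /cross xd.
(* Only the left chord needs the bound: all its later chords cross it. *)
have last_clique x y : x \notin S -> y \notin S -> #|later C (val x)| <= k ->
    source (val x) < source (val y) -> connect e x y.
  move=> xS yS le_xk xy; apply: connect1.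
  rewrite /e /= xS yS /intersection_graph /cross.
  by rewrite (terminal_cross_last Ct (valP x) le_xk) // inE (valP y).
apply/existsPn => x; apply/existsPn => y; apply/and3P => -[xS yS /negP[]].
have [x' [x'S le_x'k xx']] := to_last x xS.
have [y' [y'S le_y'k yy']] := to_last y yS.
apply: connect_trans xx' _; rewrite (sym_connect_sym e_sym).
apply: connect_trans yy' _.
case: (ltngtP (source (val y')) (source (val x'))) => [lt|gt|Esrc].
- exact: last_clique.
- by rewrite (sym_connect_sym e_sym); apply: last_clique.
- by rewrite (val_inj (source_inj (valP y') (valP x') Esrc)).
Qed.

Theorem proposition8p7 (n k : nat) (C : chord_diagram n) :
  1 <= k -> terminal C k -> k + 1 <= #|chords C| -> connected C k.
Proof.
move=> _ Ct; rewrite addn1 => le_kC.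
have ltkT : k < #|{: {c : chord n | c \in chords C}}| by rewrite card_sig.
rewrite /connected /connectivity /vertex_connectivity; case: ifP => _.
  by rewrite -ltnS prednK // (leq_ltn_trans _ ltkT).
(* The default value of the minimum, the number of chords, must also be at least [k]. *)
elim/big_ind: _ => [|a b ka kb|S]; first exact: ltnW.
  by rewrite leq_min ka.
by apply: contraLR; rewrite -ltnNge; apply: terminal_not_disconnects.
Qed.
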